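(* For $p\in(\tfrac14,\tfrac13]$ and $y\in\big(0,\tfrac{3}{1-4p^2}\big)$, there exist uncountably many sequences $(\nu_m)_{m\in\mathbb N_0}\in\prod_{m\in\mathbb N_0}\{0,1,\dots,3\cdot4^m\}$ with $$y=\sum_{m\in\mathbb N_0}\nu_m\,p^{2m}.$$
   Context: $\mathbb N_0=\{0,1,2,\dots\}$. *)

(* Defs.v *)
From mathcomp Require Export all_boot all_order all_algebra.
From mathcomp Require Export all_classical all_reals all_analysis.

(* Main.v *)
Require Import Defs.
From mathcomp Require Import all_boot all_order all_algebra.
From mathcomp Require Import all_classical all_reals all_analysis.
From mathcomp Require Import zify ring lra.
Import Order.TTheory GRing.Theory Num.Theory.
Import numFieldNormedType.Exports.
Local Open Scope classical_set_scope.
Local Open Scope ring_scope.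

(** Put [q = p ^ 2], so that [1/16 < q <= 1/9] and the weights [q ^ m] carry
    digits up to [3 * 4 ^ m]; the largest value is the geometric sum
    [3 / (1 - 4 q)].  The point is that the expansions have so much redundancy
    that infinitely many digits can be prescribed as arbitrary bits.

    Greedy expansion reaches every admissible real as soon as no weight with a
    nonzero digit bound exceeds the total contribution of the later digits
    ([greedy_expansion], the condition of Kakeya).  Here this condition
    survives the removal of every other digit from a late rank [m0] on: for
    [m >= 1] a single remaining digit is enough, at rank [m + 1] because
    [3 * 4 ^ (m + 1) * q >= 3], or at rank [m + 2] because
    [3 * 4 ^ (m + 2) * q ^ 2 >= 3 * 4 ^ m / 16 >= 3] when [m >= 2]; for [m = 0]
    the inequality [1 <= \sum_(1 <= k < m0) 3 (4 q) ^ k] holds for large [m0]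
    because the full sum is [12 q / (1 - 4 q) > 1], which needs the full
    strength of [p > 1/4].  When [m0] is large, bits put at the ranks
    [m0 + 2 k] contribute less than [y], and the digits below [m0] alone can
    exceed [y], so the remaining digits can represent what is left of [y]
    ([expansion_with_prescribed_bits]).  Cantor's diagonal argument on the
    prescribed bits then concludes ([prescribable_bits_uncountable]). *)

(** * Uncountability from freely prescribable bits *)

(** Cantor's diagonal argument: the [k]-th bit is chosen to contradict the
    digit at rank [g k] of the [k]-th sequence of an enumeration. *)
Lemma prescribable_bits_uncountable (S : set (nat -> nat)) (g : nat -> nat) :
  (forall d : nat -> bool, exists2 nu, S nu & forall k, nu (g k) = d k) ->
  ~ countable S.
Proof.
move=> free /countable_injP [f finj].
pose d k := `[< exists nu, [/\ S nu, f nu = k & nu (g k) = 0%N] >].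
have [nu Snu nuE] := free d.
have := nuE (f nu); rewrite /d.
case: asboolP => [[nu' [Snu' eqf nu'0]]|nex] nuf.
- have eq_nu : nu' = nu by apply: finj => //; rewrite inE.
  by rewrite eq_nu nuf in nu'0.
- by apply: nex; exists nu.
Qed.

(** * Greedy expansions *)

Section GreedyExpansion.
Context {R : realType} (a : nat -> nat) (w : nat -> R).

Definition greedy_digit (m : nat) (r : R) : nat := minn (a m) (Num.trunc (r / w m)).

Fixpoint greedy_remainder (x : R) (m : nat) : R :=
  if m is m'.+1 then
    let r := greedy_remainder x m' in r - (greedy_digit m' r)%:R * w m'
  else x.

Hypothesis w_gt0 : forall m, 0 < w m.

Lemma greedy_remainder_ge0 (x : R) m : 0 <= x -> 0 <= greedy_remainder x m.
Proof.
move=> x0; elim: m => //= m; set r := greedy_remainder x m => r0.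
rewrite subr_ge0 -ler_pdivlMr //.
have rw0 : 0 <= r / w m by rewrite divr_ge0 // ltW.
apply: (@le_trans _ _ (Num.trunc (r / w m))%:R); last by rewrite truncn_le.
by rewrite ler_nat geq_minr.
Qed.

Lemma series_greedy (x : R) m :
  series (fun k => (greedy_digit k (greedy_remainder x k))%:R * w k) m
    = x - greedy_remainder x m.
Proof.
rewrite seriesEnat /=; elim: m => [|m IH]; first by rewrite big_geq // subrr.
by rewrite big_nat_recr //= IH; ring.
Qed.

(** Kakeya's condition, stated with finite sums so that no limit is needed to
    run the algorithm. *)
Hypothesis kakeya : forall m, (0 < a m)%N ->
  exists n, w m <= \sum_(m.+1 <= k < n) (a k)%:R * w k.

(** The remainder never exceeds what the later digits can still contribute:
    either the digit is maximal and both sides drop by the same amount, or the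
    remainder has become smaller than the weight, which Kakeya's condition
    bounds. *)
Lemma greedy_remainder_le (x : R) m : 0 <= x ->
  (exists n, x <= \sum_(0 <= k < n) (a k)%:R * w k) ->
  exists n, greedy_remainder x m <= \sum_(m <= k < n) (a k)%:R * w k.
Proof.
move=> x0 xn; elim: m => //= m; set r := greedy_remainder x m => -[n rn].
have r0 : 0 <= r by exact: greedy_remainder_ge0.
have rw0 : 0 <= r / w m by rewrite divr_ge0 // ltW.
rewrite /greedy_digit; case: leqP => [le_a|lt_a].
- exists n; case: (ltnP m n) => mn.
    by move: rn; rewrite big_ltn // => rn; lra.
  move: rn; rewrite !big_geq //; last exact: leqW.
  by move=> rn; have := w_gt0 m; have : 0 <= (a m)%:R :> R by []; nra.
- have [|n' wn'] := kakeya m; first exact: leq_trans lt_a.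
  exists n'; apply: le_trans wn'.
  have /andP[_] := truncn_itv rw0.
  rewrite ltr_pdivrMr // -natr1 => lt_r.
  by apply: ltW; lra.
Qed.

Lemma greedy_expansion (x : R) :
  cvgn (series (fun k => (a k)%:R * w k)) -> 0 <= x ->
  (exists n, x <= \sum_(0 <= k < n) (a k)%:R * w k) ->
  exists2 c : nat -> nat, (forall m, (c m <= a m)%N) &
    series (fun k => (c k)%:R * w k) @ \oo --> x.
Proof.
move=> cv x0 xn.
exists (fun k => greedy_digit k (greedy_remainder x k)).
  by move=> m; exact: geq_minl.
have aw0 k : 0 <= (a k)%:R * w k by rewrite mulr_ge0 // ltW.
pose S := series (fun k => (a k)%:R * w k).
have S_le n : S n <= limn S.
  by apply: nondecreasing_cvgn_le => //; exact: nondecreasing_series.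
have remainder_to0 : greedy_remainder x @ \oo --> 0.
  apply: (@squeeze_cvgr _ _ _ _ (fun=> 0) (fun m => limn S - S m)).
  - apply: nearW => m; rewrite greedy_remainder_ge0 //=.
    have [n rn] := greedy_remainder_le x m x0 xn.
    apply: (le_trans rn); have := S_le n; rewrite /S !seriesEnat /=.
    case: (leqP m n) => mn.
      rewrite (big_cat_nat (n := m)) //=; lra.
    by move=> _; rewrite big_geq ?(ltnW mn)// subr_ge0; exact: S_le.
  - exact: cvg_cst.
  - by rewrite -[X in _ --> X](subrr (limn S)); apply: cvgB => //; exact: cvg_cst.
rewrite (_ : series _ = fun m => x - greedy_remainder x m); last first.
  by apply/funext => m; exact: series_greedy.
by rewrite -[X in _ --> X]subr0; apply: cvgB => //; exact: cvg_cst.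
Qed.

End GreedyExpansion.

(** * Expansions with prescribed bits *)

(** The ranks [m0 + 2 k] are set aside for the prescribed bits.  Taking only
    every other rank leaves a digit free among any two consecutive ones, as
    Kakeya's condition requires. *)
Definition reserved (m0 m : nat) : bool := (m0 <= m)%N && ~~ odd (m - m0).

(** Subtract the contribution [L] of the prescribed bits from [y] and expand
    [y - L] greedily with the other digits.  The four hypotheses on [m0] hold
    for all large enough [m0] when [1/16 < q] and [0 < y < 3 / (1 - 4 * q)]:
    the bound on [4^-1 ^+ m0] gives [L <= y], the next one makes [y - L]
    reachable, and the last is Kakeya's condition at rank 0 once the term 3 of
    rank 0 is removed. *)
Lemma expansion_with_prescribed_bits (R : realType) (q y : R) (m0 : nat) :
  1 / 16 < q <= 1 / 9 -> (3 <= m0)%N ->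
  4^-1 ^+ m0 / (1 - 4 * q) < y ->
  y < series (geometric 3 (4 * q)) m0 ->
  4 < series (geometric 3 (4 * q)) m0 ->
  forall d : nat -> bool, exists nu : nat -> nat,
    [/\ forall m, (nu m <= 3 * 4 ^ m)%N,
        series (fun m => (nu m)%:R * q ^+ m) @ \oo --> y
      & forall k, nu (m0 + k.*2)%N = d k].
Proof.
move=> /andP[q_gt q_le] m0_ge small y_lt S_gt d.
have q0 : 0 < q by lra.
have q4_lt1 : `|4 * q| < 1 by rewrite ger0_norm; lra.
pose l m : nat := if reserved m0 m then nat_of_bool (d (m - m0)./2) else 0%N.
pose a m : nat := if reserved m0 m then 0%N else (3 * 4 ^ m)%N.
have la m : (l m + a m <= 3 * 4 ^ m)%N.
  rewrite /l /a; case: ifP => _ //; rewrite addn0.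
  by apply: leq_trans (leq_b1 _) _; rewrite muln_gt0 expn_gt0.
have bound0 m : 0 <= geometric 3 (4 * q) m by rewrite /= mulr_ge0 ?exprn_ge0//; lra.
have boundE m : (3 * 4 ^ m)%:R * q ^+ m = geometric 3 (4 * q) m.
  by rewrite /= natrM natrX exprMn mulrA.
have a_cvg : cvgn (series (fun m => (a m)%:R * q ^+ m)).
  apply: (@series_le_cvg _ _ (geometric 3 (4 * q))) => [m|//|m|].
  - by rewrite mulr_ge0 // exprn_ge0 // ltW.
  - rewrite -boundE ler_wpM2r ?exprn_ge0 ?(ltW q0)// ler_nat.
    by apply: leq_trans (la m); exact: leq_addl.
  - by apply/cvg_ex; eexists; exact: cvg_geometric_series.
(* A bit is placed only at ranks [m >= m0], where [1 <= 4 ^ m / 4 ^ m0]. *)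
have l_le m : (l m)%:R * q ^+ m <= geometric (4^-1 ^+ m0) (4 * q) m.
  rewrite /= exprMn mulrA ler_wpM2r ?exprn_ge0 ?(ltW q0)//.
  rewrite /l /reserved; case: (leqP m0 m) => /= m0m; last first.
    by rewrite mulr_ge0 ?exprn_ge0 ?invr_ge0.
  apply: (@le_trans _ _ 1); first by case: ifP => // _; rewrite lern1 leq_b1.
  rewrite -(subnK m0m) exprD mulrCA -exprMn mulVf // expr1n mulr1.
  by rewrite exprn_ege1 //; lra.
have l0 m : 0 <= (l m)%:R * q ^+ m by rewrite mulr_ge0 // exprn_ge0 // ltW.
have geo_cvg := cvg_geometric_series (a := 4^-1 ^+ m0) q4_lt1.
have l_cvg : cvgn (series (fun m => (l m)%:R * q ^+ m)).
  apply: (series_le_cvg l0 _ l_le); last by apply/cvg_ex; eexists; exact: geo_cvg.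
  by move=> m; apply: le_trans (l_le m).
set L := limn (series (fun m => (l m)%:R * q ^+ m)) in l_cvg.
have L_le : L <= y.
  apply: le_trans (ltW small); rewrite -(cvg_lim _ geo_cvg)//.
  by apply: lim_series_le => //; apply/cvg_ex; eexists; exact: geo_cvg.
have L_ge : 0 <= L.
  by apply: limr_ge => //; apply: nearW => n; rewrite seriesEnat /= sumr_ge0.
have aE m : (m < m0)%N -> a m = (3 * 4 ^ m)%N.
  by move=> m_lt; rewrite /a /reserved leqNgt m_lt.
have a_start i : \sum_(i <= k < m0) (a k)%:R * q ^+ k =
                 \sum_(i <= k < m0) geometric 3 (4 * q) k.
  by apply: eq_big_nat => k /andP[_ k_lt]; rewrite aE // boundE.
have aq0 m : 0 <= (a m)%:R * q ^+ m by rewrite mulr_ge0 // exprn_ge0 // ltW.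
have kak m : (0 < a m)%N ->
    exists n, q ^+ m <= \sum_(m.+1 <= k < n) (a k)%:R * q ^+ k.
  case: m => [_|m am].
    exists m0; rewrite a_start; move: S_gt; rewrite seriesEnat /=.
    by rewrite big_ltn ?(leq_trans _ m0_ge)// !expr0; lra.
  have one_term j : (m.+1 < j)%N -> q ^+ m.+1 <= (a j)%:R * q ^+ j ->
      exists n, q ^+ m.+1 <= \sum_(m.+2 <= k < n) (a k)%:R * q ^+ k.
    move=> mj le_j; exists j.+1; rewrite big_nat_recr //=.
    by apply: le_trans le_j _; rewrite lerDr sumr_ge0.
  have [res1|res1] := boolP (reserved m0 m.+2).
  (* Reserved ranks are never consecutive, so the digit at rank [m + 3] is
     free.  It loses a further factor [q], made up for by [4 ^ m] as
     [m + 2 >= m0 >= 3]. *)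
  - have a3 : a m.+3 = (3 * 4 ^ m.+3)%N.
      rewrite /a /reserved; case: ifP => //; move: res1; rewrite /reserved.
      clear -m0_ge; lia.
    apply: (one_term m.+3) => //; rewrite a3 natrM natrX !exprS.
    have qm : 0 < q ^+ m by rewrite exprn_gt0.
    have m_gt0 : (0 < m)%N by move: res1; rewrite /reserved; clear -m0_ge; lia.
    have pw : 4 <= 4 ^+ m :> R by rewrite -[X in X <= _]expr1 ler_weXn2l //; lra.
    rewrite [leRHS](_ : _ = (192 * 4 ^+ m * q ^+ 2) * (q * q ^+ m)); last by ring.
    rewrite ler_peMl ?mulr_ge0 ?(ltW qm) ?(ltW q0)//.
    have q2 : 1 / 256 <= q ^+ 2 by nra.
    nra.
  - have a2 : a m.+2 = (3 * 4 ^ m.+2)%N by rewrite /a (negbTE res1).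
    apply: (one_term m.+2) => //; rewrite a2 natrM natrX !exprS.
    have qm : 0 < q ^+ m by rewrite exprn_gt0.
    have pw : 1 <= 4 ^+ m :> R by rewrite exprn_ege1 //; lra.
    rewrite [leRHS](_ : _ = (48 * 4 ^+ m * q) * (q * q ^+ m)); last by ring.
    rewrite ler_peMl ?mulr_ge0 ?(ltW qm) ?(ltW q0)//.
    nra.
have [|||c c_le c_cvg] := @greedy_expansion R a (fun m => q ^+ m) _ kak (y - L) a_cvg.
- by move=> m; exact: exprn_gt0.
- by rewrite subr_ge0.
- by exists m0; rewrite a_start; move: y_lt; rewrite seriesEnat /=; lra.
exists (fun m => l m + c m)%N; split.
- by move=> m; apply: leq_trans (la m); rewrite leq_add2l.
- rewrite (_ : series _ = series (fun m => (l m)%:R * q ^+ m) +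
                          series (fun m => (c m)%:R * q ^+ m)).
    by rewrite -(subrKC L y); apply: cvgD.
  by rewrite -seriesD; congr series; apply/funext => m; rewrite natrD mulrDl.
- move=> k; have res : reserved m0 (m0 + k.*2).
    by rewrite /reserved leq_addr addKn odd_double.
  have : (c (m0 + k.*2) <= 0)%N by have := c_le (m0 + k.*2)%N; rewrite /a res.
  by rewrite leqn0 => /eqP ->; rewrite /l res addKn doubleK addn0.
Qed.

Theorem theorem4p3 (R : realType) (p y : R)
    (hp : 1 / 4 < p <= 1 / 3) (hy : 0 < y < 3 / (1 - 4 * p ^+ 2)) :
  ~ countable [set nu : nat -> nat |
      (forall m : nat, (nu m <= 3 * 4 ^ m)%N) /\
      series (fun m : nat => (nu m)%:R * p ^+ (2 * m)) @ \oo --> y].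
Proof.
move: hp hy => /andP[p_gt p_le] /andP[y_gt y_lt].
set q := p ^+ 2 in y_lt.
have q_itv : 1 / 16 < q <= 1 / 9 by rewrite /q; apply/andP; split; nra.
have /andP[q_gt q_le] := q_itv.
have q4_lt1 : `|4 * q| < 1 by rewrite ger0_norm; lra.
have S_cvg := cvg_geometric_series (a := 3) q4_lt1.
have S_gt4 : 4 < 3 / (1 - 4 * q) by rewrite ltr_pdivlMr; lra.
have quarter : `|4^-1 : R| < 1 by rewrite ger0_norm; lra.
have small_cvg : 4^-1 ^+ m / (1 - 4 * q) @[m --> \oo] --> 0.
  rewrite -[X in _ --> X](mul0r (1 - 4 * q)^-1).
  by apply: cvgM; [exact: cvg_expr quarter | exact: cvg_cst].
have [m0 [m0_ge small large large4]] : exists m0, [/\ (3 <= m0)%N,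
    4^-1 ^+ m0 / (1 - 4 * q) < y, y < series (geometric 3 (4 * q)) m0
    & 4 < series (geometric 3 (4 * q)) m0].
  near \oo => m0; exists m0; split; near: m0.
  - exact: nbhs_infty_ge.
  - exact: (cvgr_lt _ small_cvg).
  - exact: (cvgr_gt _ S_cvg).
  - exact: (cvgr_gt _ S_cvg).
apply: (@prescribable_bits_uncountable _ (fun k => m0 + k.*2)%N) => d.
have [nu [nu_le nu_cvg nu_d]] :=
  @expansion_with_prescribed_bits R q y m0 q_itv m0_ge small large large4 d.
exists nu => //; split=> //.
rewrite (_ : (fun m => _) = fun m => (nu m)%:R * q ^+ m) //.
by apply/funext => m; rewrite exprM.
Unshelve. all: by end_near.
Qed.
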